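(* Let $m\in(2,\infty)$ and, for $s>0$, $$T_{\Delta_\varphi}(s;m)=-K_{\Delta_k}(1;m)\frac{s^{-m/2}-1}{s-1}+H_{\Delta_k}(s,s^{-1};m)$$ with $K_{\Delta_k},H_{\Delta_k}$ as in the context. Then, in terms of hypergeometric functions, $$T_{\Delta_\varphi}(s;m)=-K_{\Delta_k}(1;m)\frac{s^{-m/2}-1}{s-1}+\tfrac13\big(1+\tfrac2m\big)\Gamma(\tfrac m2+2)\,{}_2F_1(\tfrac m2+2,1;4;1-s)-\tfrac1{3m}\Gamma(\tfrac m2+3)\,{}_2F_1(\tfrac m2+3,1;5;1-s)-\tfrac1{6m}\Gamma(\tfrac m2+3)\,s\,{}_2F_1(\tfrac m2+3,2;5;1-s).$$ Moreover, with $a=m/2$ and $s\ne1$, this equals $$\frac{\Gamma(a-1)}{6a}\,(s-1)^{-4}s^{-a}\Big[-3a^2(s-1)^2\big(s-1+s^a(1+s)\big)+2a\big((s-1)^3+(s-1)s^a(-2+s(7+s))\big)+a^3(s-1)^3(s^a+1)-12s^2(s^a-1)\Big].$$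
   Context: For $s,t>0$ and real $m>2$, $$K_{\Delta_k}(s;m)=-\tfrac12\Gamma(\tfrac m2+1)\,{}_2F_1(\tfrac m2+1,1;3;1-s)+\tfrac{2}{3m}\Gamma(\tfrac m2+2)\,{}_2F_1(\tfrac m2+2,1;4;1-s),$$ so that $K_{\Delta_k}(1;m)=\frac{2\Gamma(m/2+2)}{3m}-\frac{\Gamma(m/2+1)}2$, and $$H_{\Delta_k}(s,t;m)=\tfrac1{6m}\Big[2(m+2)\Gamma(\tfrac m2+2)F_1(\tfrac m2+2;1,1;4;1-st,1-s)-2\Gamma(\tfrac m2+3)F_1(\tfrac m2+3;1,1;5;1-st,1-s)-s\,\Gamma(\tfrac m2+3)F_1(\tfrac m2+3;1,2;5;1-st,1-s)\Big],$$ with ${}_2F_1$ Gauss's hypergeometric function and $F_1$ Appell's first function, given for real $x,y<1$ by $$F_1(\alpha;\beta,\beta';\gamma;x,y)=\frac{\Gamma(\gamma)}{\Gamma(\beta)\Gamma(\beta')\Gamma(\gamma-\beta-\beta')}\int_{p,q\ge0,\,p+q\le1}p^{\beta-1}q^{\beta'-1}(1-p-q)^{\gamma-\beta-\beta'-1}(1-xp-yq)^{-\alpha}dp\,dq.$$ The quotient $(s^{-m/2}-1)/(s-1)$ is extended continuously to $s=1$. *)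

(* Defs.v *)
From HB Require Import structures.
From mathcomp Require Export all_boot all_order all_algebra.
From mathcomp Require Export all_classical all_reals all_analysis.
Export Order.TTheory GRing.Theory Num.Theory numFieldNormedType.Exports.

Set Implicit Arguments.
Unset Strict Implicit.
Unset Printing Implicit Defensive.

Local Open Scope classical_set_scope.
Local Open Scope ring_scope.

(* Euler's integral; the meaningful range is x > 0. *)
Definition Gamma (R : realType) (x : R) : R :=
  \int[lebesgue_measure]_(t in `]0, +oo[) (t `^ (x - 1) * expR (- t)).

Definition pochhammer (R : realType) (a : R) (n : nat) : R :=
  \prod_(i < n) (a + i%:R).

Definition gauss_coef (R : realType) (a b c : R) (n : nat) : R :=
  pochhammer a n * pochhammer b n / (pochhammer c n * n`!%:R).

Definition analytic_at (R : realType) (F : R -> R) (x : R) : Prop :=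
  exists u : R^nat, \forall z \near x, pseries u (z - x) @ \oo --> F z.

Definition is_hyp2F1 (R : realType) (a b c : R) (F : R -> R) : Prop :=
  (forall z, `|z| < 1 -> pseries (gauss_coef a b c) z @ \oo --> F z) /\
  (forall z, z < 1 -> analytic_at F z).

(* Gauss's hypergeometric function on the real half-line z < 1: the analytic
   continuation to ]-oo, 1[ of the Gauss series, which converges for |z| < 1
   only. The continuation exists and is unique on ]-oo, 1[ when c is not a
   nonpositive integer; values at z >= 1 are irrelevant. *)
Definition hyp2F1 (R : realType) (a b c z : R) : R :=
  xget (fun=> 0) [set F : R -> R | is_hyp2F1 a b c F] z.

(* Appell's first function, for real x, y < 1 and positive b, b', c - b - b';
   the integral is over the triangle in the (p, q)-plane, with respect to
   two-dimensional Lebesgue measure, z = (p, q). *)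
Definition appellF1 (R : realType) (a b b' c x y : R) : R :=
  Gamma c / (Gamma b * Gamma b' * Gamma (c - b - b')) *
  \int[(lebesgue_measure \x lebesgue_measure)%E]_(z in
      [set z : R * R | [/\ 0 <= z.1, 0 <= z.2 & z.1 + z.2 <= 1]])
    (z.1 `^ (b - 1) * z.2 `^ (b' - 1) * (1 - z.1 - z.2) `^ (c - b - b' - 1) *
     (1 - x * z.1 - y * z.2) `^ (- a)).

Definition K_Delta_k (R : realType) (s m : R) : R :=
  - (1 / 2) * Gamma (m / 2 + 1) * hyp2F1 (m / 2 + 1) 1 3 (1 - s) +
  2 / (3 * m) * Gamma (m / 2 + 2) * hyp2F1 (m / 2 + 2) 1 4 (1 - s).

Definition H_Delta_k (R : realType) (s t m : R) : R :=
  1 / (6 * m) *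
  (2 * (m + 2) * Gamma (m / 2 + 2) *
     appellF1 (m / 2 + 2) 1 1 4 (1 - s * t) (1 - s) -
   2 * Gamma (m / 2 + 3) *
     appellF1 (m / 2 + 3) 1 1 5 (1 - s * t) (1 - s) -
   s * Gamma (m / 2 + 3) *
     appellF1 (m / 2 + 3) 1 2 5 (1 - s * t) (1 - s)).

(* (s^(-m/2) - 1) / (s - 1), extended to s = 1 by its limit there. *)
Definition power_quotient (R : realType) (m s : R) : R :=
  let q (u : R) := (u `^ (- (m / 2)) - 1) / (u - 1) in
  if s == 1 then lim (q u @[u --> (1 : R)^']) else q s.

Definition T_Delta_phi (R : realType) (s m : R) : R :=
  - K_Delta_k 1 m * power_quotient m s + H_Delta_k s s^-1 m.

(* Main.v *)
Require Import Defs.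
From HB Require Import structures.
From mathcomp Require Import all_boot all_order all_algebra.
From mathcomp Require Import all_classical all_reals all_analysis.
From mathcomp Require Import measurable_realfun.
From mathcomp Require Import ring lra.
Import Order.TTheory GRing.Theory Num.Theory numFieldNormedType.Exports.

(** At [t = s^-1] the first variable [1 - s * t] of the three Appell functions
    vanishes. Their integrand over the triangle then depends on [p] only through
    [(1 - p - q) ^+ k], so integrating out [p] by Tonelli's theorem leaves a
    single Euler integral
      [euler_int i j (- a) z], the integral over [0 <= t <= 1] of
      [t ^+ i * (1 - t) ^+ j * (1 - z * t) `^ (- a)],
    and each Appell function is a Gauss function ([appellF1_x0]). This is the
    first formula.

    To use it, the Gauss function, which is specified as an analytic
    continuation, has to be identified with Euler's integral for every [z < 1]
    ([hyp2F1_euler]). Around any centre [x0 < 1] the kernel [(1 - z * t) `^ (- a)]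
    has a binomial expansion in [z - x0], uniform in [t], on the disc
    [`|z - x0| < 1 - x0]; integrating it term by term shows that Euler's integral
    is analytic ([euler_int_expansion]), and for [x0 = 0] Beta integrals turn the
    coefficients into those of the Gauss series ([gauss_coef_euler]). The
    continuation is unique by the identity theorem for real analytic functions
    ([analytic_eq0_left]).

    For the second formula, writing [1 - t] and [t] as affine functions of
    [1 - z * t] lowers [i] and [j] at the cost of shifting the exponent
    ([euler_intSl], [euler_int_subSr]). The integrals end up as combinations of
    integrals of pure powers of [1 - z * t], which are elementary when [z != 0];
    the values of Gamma reduce to [Gamma (a - 1)] by the functional equation
    ([GammaD1]), and a rational identity in [a], [s], [s `^ a] and
    [Gamma (a - 1)] remains ([closed_form_identity]). *)

Set Implicit Arguments.
Unset Strict Implicit.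
Unset Printing Implicit Defensive.

Local Open Scope classical_set_scope.
Local Open Scope ring_scope.

(** * Identity theorem for real analytic functions *)

Lemma pseriesS (R : realType) (u : R^nat) (h : R) (n : nat) :
  pseries u h n.+1 = u 0%N + h * pseries (fun k => u k.+1) h n.
Proof.
rewrite /pseries /series/= big_nat_recl//= expr0 mulr1; congr (_ + _).
by rewrite big_distrr/=; apply: eq_bigr => k _; rewrite exprS mulrCA.
Qed.

(** By absolute convergence at a fixed radius [h0], the sum differs from its
    constant term by at most [h * L] for all [h <= h0], with [L] independent of
    [h]; letting [h] tend to 0 kills the constant term. The values of [h] are
    positive because a function that vanishes on an interval is studied at the
    left end of that interval. *)
Lemma pseries0_coef0 (R : realType) (u : R^nat) (d : R) : 0 < d ->
  (forall h, 0 < h < d -> pseries u h @ \oo --> (0 : R)) -> u 0%N = 0.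
Proof.
move=> d0 Hu.
(* Convergence at [d / 2] makes the series absolutely convergent at the smaller
   radius [d / 4]. *)
pose h0 := d / 4.
have h00 : 0 < h0 by rewrite /h0; lra.
have cu : cvgn (pseries u (d / 2)) by apply/cvg_ex; exists 0; apply: Hu; lra.
have cv : cvgn (pseries (fun n => `|u n|) h0).
  apply: is_cvg_pseries_inside_norm cu _.
  by rewrite !gtr0_norm//; rewrite /h0; lra.
pose L := limn (pseries (fun n => `|u n|) h0) / h0.
have boundL h N : 0 < h <= h0 -> `|pseries (fun k => u k.+1) h N| <= L.
  move=> /andP[hp hh0].
  rewrite /L ler_pdivlMr//.
  apply: (@le_trans _ _ (pseries (fun n => `|u n|) h0 N.+1)).
    rewrite pseriesS -[leLHS]add0r lerD// mulrC ler_pM2l//.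
    rewrite /pseries /series/= (le_trans (ler_norm_sum _ _ _))//.
    apply: ler_sum => k _; rewrite normrM normrX ler_wpM2l//.
    by rewrite lerXn2r ?nnegrE ?(ltW h00)// gtr0_norm.
  apply: nondecreasing_cvgn_le => //.
  apply: nondecreasing_series => k _ _.
  by rewrite mulr_ge0// exprn_ge0// ltW.
have key h : 0 < h <= h0 -> `|u 0%N| <= h * L.
  move=> hh; have := hh => /andP[hp hle].
  have : `|pseries u h n| @[n --> \oo] --> `|0 : R|.
    by apply: cvg_norm; apply: Hu; rewrite hp (le_lt_trans hle)// /h0; lra.
  rewrite normr0 => c0; rewrite -subr_le0.
  apply: (@ler_cvg_to _ _ _ _ (fun _ : nat => `|u 0%N| - h * L) _ _ _ (cvg_cst _) c0).
  near=> n.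
  have -> : n = n.-1.+1 by rewrite prednK//; near: n; exists 1%N.
  rewrite pseriesS lerBlDr.
  apply: (@le_trans _ _ (`|u 0%N + h * pseries (fun k => u k.+1) h n.-1|
    + `|h * pseries (fun k => u k.+1) h n.-1|)).
    by rewrite -[X in `|X| <= _](addrK (h * pseries (fun k => u k.+1) h n.-1)) ler_normB.
  by rewrite lerD2l normrM gtr0_norm// ler_pM2l// boundL.
apply/eqP; rewrite -normr_le0; apply/ler_addgt0Pl => e e0; rewrite addr0.
have L0 : 0 <= L by apply: le_trans (boundL h0 0%N _); rewrite ?h00 ?lexx.
pose h := Num.min h0 (e / (L + 1)).
have h1 : 0 < h by rewrite /h lt_min h00 divr_gt0//; lra.
apply: le_trans (key h _) _; first by rewrite h1 /h ge_min lexx.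
apply: (@le_trans _ _ (e / (L + 1) * L)).
  by rewrite ler_wpM2r// /h ge_min lexx orbT.
rewrite mulrAC ler_pdivrMr; last by lra.
by rewrite ler_pM2l//; lra.
Unshelve. all: by end_near. Qed.

(** Once the constant term is known to vanish, the series divided by [h] is again
    a power series with sum 0, and induction applies. *)
Lemma pseries0_coef (R : realType) (u : R^nat) (d : R) : 0 < d ->
  (forall h, 0 < h < d -> pseries u h @ \oo --> (0 : R)) -> u = fun=> 0.
Proof.
move=> d0 Hu; apply/funext => n.
elim: n u Hu => [|n IH] u Hu; first exact: pseries0_coef0 Hu.
apply: (IH (fun k => u k.+1)) => h hd.
have h0 : h != 0 by case/andP: hd => h0 _; rewrite gt_eqF.
have u0 : u 0%N = 0 by exact: pseries0_coef0 Hu.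
have -> : pseries (fun k => u k.+1) h = (fun n => h^-1 * pseries u h n.+1).
  by apply/funext => k; rewrite pseriesS u0 add0r mulKf.
rewrite -(mulr0 h^-1); apply: cvgM; first exact: cvg_cst.
by rewrite (cvg_shiftS (pseries u h)); exact: Hu.
Qed.

Lemma analytic_atB (R : realType) (F G : R -> R) (x : R) :
  analytic_at F x -> analytic_at G x -> analytic_at (fun z => F z - G z) x.
Proof.
move=> [u Hu] [v Hv]; exists (fun n => u n - v n).
near=> z.
have -> : pseries (fun n => u n - v n) (z - x) =
  (fun n => pseries u (z - x) n - pseries v (z - x) n).
  apply/funext => n; rewrite /pseries /series/= -sumrB.
  by apply: eq_bigr => k _; rewrite mulrBl.
by apply: cvgB; near: z.
Unshelve. all: by end_near. Qed.

(** Let [x] be the infimum of the points [y] such that [H] vanishes on the interval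
    from [y] to [b]. The power series of [H] at [x] has sum 0 to the right of [x],
    hence has zero coefficients, hence [H] vanishes also slightly to the left of
    [x], which contradicts the choice of [x]. *)
Lemma analytic_eq0_left (R : realType) (H : R -> R) (b c : R) : c < b ->
  (forall z, z < b -> analytic_at H z) ->
  (forall z, c < z < b -> H z = 0) -> forall z, z < b -> H z = 0.
Proof.
move=> cb aH H0 z0 z0b.
apply/eqP/negPn/negP => Hz0.
pose S := [set y : R | y < b /\ forall w, y < w < b -> H w = 0].
have Sc : S c by split.
have Slb y : S y -> z0 <= y.
  move=> [_ Sy]; rewrite leNgt; apply/negP => yz0.
  by move: Hz0; rewrite (Sy z0) ?eqxx// yz0 z0b.
have infS : has_inf S by split; [exists c|exists z0 => y /Slb].
pose x := inf S.
have xc : x <= c by apply: ge_inf => //; case: infS.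
have xb : x < b by exact: le_lt_trans xc cb.
have Hx w : x < w < b -> H w = 0.
  move=> /andP[xw wb].
  have [y Sy yw] := inf_lt infS.1 xw.
  by apply: Sy.2; rewrite yw wb.
have [u /nbhs_ballP[d /= d0 Hu]] := aH _ xb.
pose d' := Num.min d (b - x).
have d'0 : 0 < d' by rewrite lt_min d0/= subr_gt0.
have u0 : u = fun=> 0.
  apply: (@pseries0_coef _ u d') => // h /andP[h0 hd].
  have hd1 : h < d by rewrite (lt_le_trans hd)// ge_min lexx.
  have hd2 : h < b - x by rewrite (lt_le_trans hd)// ge_min lexx orbT.
  have := Hu (x + h); rewrite /ball/= opprD addNKr normrN gtr0_norm//.
  move=> /(_ hd1); rewrite (addrC x) addrK Hx//; lra.
suff : S (x - d / 2).
  move=> /(ge_inf infS.2); rewrite -/x; lra.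
split; first by lra.
move=> w /andP[xw wb].
have [xw'|wx] := ltP x w; first by apply: Hx; rewrite xw' wb.
have : ball x d w.
  by rewrite /ball/= ger0_norm; lra.
move=> /Hu; rewrite u0 => c1.
apply/esym; apply: (cvg_unique _ _ c1) => //.
have -> : pseries (fun=> 0 : R) (w - x) = fun=> 0.
  apply/funext => n; rewrite /pseries /series/= big1// => k _.
  by rewrite mul0r.
exact: cvg_cst.
Qed.

(** * The binomial series with real exponent *)

Lemma cvg0_ratio (R : realType) (u : R^nat) (q : R) : 0 <= q < 1 ->
  (forall n, 0 <= u n) -> (\forall n \near \oo, u n.+1 <= q * u n) ->
  u @ \oo --> (0 : R).
Proof.
move=> /andP[q0 q1] u0 [N _ HN].
have le_geo k : u (k + N)%N <= u N * q ^+ k.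
  elim: k => [|k IH]; first by rewrite mulr1.
  rewrite addSn exprS mulrCA (le_trans (HN _ _))//=; first exact: leq_addl.
  by rewrite ler_wpM2l.
rewrite -(cvg_shiftn N); apply: (@squeeze_cvgr _ _ _ _ (cst 0) (geometric (u N) q)).
- by near=> k; rewrite u0 le_geo.
- exact: cvg_cst.
- by apply: cvg_geometric; rewrite ger0_norm.
Unshelve. all: by end_near. Qed.

Lemma powR_mulB1 (R : realType) (p x : R) : 0 < x -> x `^ p = x * x `^ (p - 1).
Proof.
move=> x0; rewrite -{2}(powRr1 (ltW x0)) -powRD ?(gt_eqF x0) ?implybT//.
by congr (_ `^ _); ring.
Qed.

(** A power function is monotone, in a direction that depends on the sign of the
    exponent; adding the two endpoint values gives a bound valid in both cases. *)
Lemma powR_le_endpoints (R : realType) (lo hi x p : R) : 0 < lo -> lo <= x <= hi ->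
  x `^ p <= lo `^ p + hi `^ p.
Proof.
move=> lo0 /andP[lox xhi].
have x0 : 0 < x by exact: lt_le_trans lox.
have [p0|p0] := leP 0 p.
  rewrite -[leLHS]add0r lerD ?powR_ge0//.
  by rewrite ge0_ler_powR ?nnegrE ?(ltW x0)// ltW// (lt_le_trans x0).
rewrite -[leLHS]addr0 lerD ?powR_ge0//.
rewrite -[p]opprK !(powRN _ (- p)) lef_pV2 ?posrE ?powR_gt0//.
by rewrite ge0_ler_powR ?nnegrE ?(ltW x0) ?(ltW lo0)// oppr_ge0 ltW.
Qed.

Lemma le_derive_dist0 (R : realType) (f df : R -> R) (r M v : R) :
  `|v| <= r -> (forall x : R, `|x| <= r -> is_derive x 1 f (df x)) ->
  (forall x : R, `|x| <= r -> `|df x| <= M) -> `|f v - f 0| <= M * r.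
Proof.
move=> vr Hd HM.
have r0 : 0 <= r by exact: le_trans vr.
have M0 : 0 <= M by apply: le_trans (HM 0 _); rewrite ?normr0.
have cf (x : R) : `|x| <= r -> {for x, continuous f}.
  move=> /Hd Hdx; apply/differentiable_continuous/derivable1_diffP.
  exact: ex_derive.
move: vr; rewrite ler_norml => /andP[v1 v2].
have [v0|v0] := leP 0 v.
  have inr x : x \in `[0, v] -> `|x| <= r.
    by rewrite in_itv/= => /andP[x0 xv]; rewrite ger0_norm// (le_trans xv).
  have [|| c /inr /HM cM ->] := @MVT_segment _ f df _ _ v0.
  - by move=> x xv; apply/Hd/inr; apply: subset_itv_oo_cc xv.
  - by apply: continuous_in_subspaceT => x; rewrite inE => /inr; exact: cf.
  by rewrite subr0 normrM (ger0_norm v0) ler_pM.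
have inr x : x \in `[v, 0] -> `|x| <= r.
  by rewrite in_itv/= => /andP[x0 xv]; rewrite ler0_norm// lerNl (le_trans v1).
have [|| c /inr /HM cM] := @MVT_segment _ f df _ _ (ltW v0).
- by move=> x xv; apply/Hd/inr; apply: subset_itv_oo_cc xv.
- by apply: continuous_in_subspaceT => x; rewrite inE => /inr; exact: cf.
rewrite distrC => ->; rewrite sub0r normrM normrN (ltr0_norm v0) ler_pM ?oppr_ge0 ?(ltW v0)//.
by rewrite lerNl.
Qed.

(** The Taylor coefficients at 0 of [(1 - v) `^ (- a)]. *)
Definition binom_coef (R : realType) (a : R) (n : nat) : R :=
  pochhammer a n / n`!%:R.

Lemma pochhammerS (R : realType) (a : R) n :
  pochhammer a n.+1 = pochhammer a n * (a + n%:R).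
Proof. by rewrite /pochhammer big_ord_recr. Qed.

Lemma binom_coefS (R : realType) (a : R) n :
  n.+1%:R * binom_coef a n.+1 = (a + n%:R) * binom_coef a n.
Proof.
rewrite /binom_coef pochhammerS factS natrM.
have n1 : n.+1%:R != 0 :> R by rewrite pnatr_eq0.
by rewrite invfM mulrCA mulVKf// mulrAC mulrC.
Qed.

Lemma cvg_binom_coef (R : realType) (a r : R) : 0 <= r < 1 ->
  (fun n => n.+1%:R * `|binom_coef a n.+1| * r ^+ n) @ \oo --> (0 : R).
Proof.
move=> /andP[r0 r1].
apply: (@cvg0_ratio _ _ ((1 + r) / 2)).
- by lra.
- by move=> n; apply: mulr_ge0; [exact: mulr_ge0|exact: exprn_ge0].
(* The ratio of consecutive terms tends to [r], so it is eventually below the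
   midpoint of [r] and 1. *)
near=> n.
have -> : n.+2%:R * `|binom_coef a n.+2| = `|a + n.+1%:R| * `|binom_coef a n.+1|.
  by rewrite -normrM -binom_coefS (normrM n.+2%:R) normr_nat.
rewrite exprS; set c := `|binom_coef _ _|; set rn := r ^+ n.
have -> : `|a + n.+1%:R| * c * (r * rn) = (`|a + n.+1%:R| * r) * (c * rn) by ring.
have -> : (1 + r) / 2 * (n.+1%:R * c * rn) = ((1 + r) / 2 * n.+1%:R) * (c * rn) by ring.
apply: ler_wpM2r; first by apply: mulr_ge0; [exact: normr_ge0|exact: exprn_ge0].
have H : 2 * `|a| * r / (1 - r) <= n.+1%:R.
  apply: le_trans (_ : n%:R <= _); last by rewrite ler_nat.
  by near: n; exact: nbhs_infty_ger.
apply: (@le_trans _ _ ((`|a| + n.+1%:R) * r)).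
  by rewrite ler_wpM2r// (le_trans (ler_normD _ _))// normr_nat.
move: H; rewrite ler_pdivrMr; last by lra.
set x := n.+1%:R; nra.
Unshelve. all: by end_near. Qed.

(** The binomial function solves [(1 - v) * f' = a * f]; a partial sum of its Taylor
    series solves this equation up to a single monomial, because the recurrence
    [binom_coefS] makes all other terms cancel. *)
Lemma binom_pseries_derive (R : realType) (a v : R) (N : nat) :
  exists2 d, is_derive v 1 (fun w => pseries (binom_coef a) w N) d &
    (1 - v) * d = a * pseries (binom_coef a) v N
                  - N%:R * binom_coef a N * v ^+ N.-1.
Proof.
elim: N => [|N [d Hd Ed]].
  exists 0; last by rewrite /pseries /series/= big_geq// !mulr0 !mul0r subr0.
  rewrite [X in is_derive _ _ X _](_ : _ = cst 0); first exact: is_derive_cst.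
  by apply/funext => w; rewrite /pseries /series/= big_geq.
exists (d + binom_coef a N * (N%:R * v ^+ N.-1)).
  rewrite [X in is_derive _ _ X _](_ : _ = (fun w => pseries (binom_coef a) w N)
      + binom_coef a N *: (fun w : R => w ^+ N)).
    apply: is_deriveD; apply: is_deriveZ.
    rewrite (_ : (fun w : R => w ^+ N) = (@id R) ^+ N); last by rewrite exprfctE.
    have H := is_deriveX N (is_derive_id v (1 : R)).
    by apply: (is_derive_eq H); rewrite /GRing.scale/= mulr1.
  by apply/funext => w; rewrite /pseries /series/= big_nat_recr.
rewrite mulrDr Ed /= [N.+1%:R * _]binom_coefS.
rewrite {2}/pseries /series/= big_nat_recr//=.
have vN : N%:R * v ^+ N = N%:R * (v * v ^+ N.-1).
  by case: N {Hd Ed} => [|n]; rewrite ?mul0r//= exprS.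
set S := pseries _ _ _; set b := binom_coef a N.
have -> : (a + N%:R) * b * v ^+ N = a * b * v ^+ N + b * (N%:R * v ^+ N) by ring.
by rewrite vN -[\sum_(0 <= i < N) _]/S; ring.
Qed.

(** With [S] the partial sum of order [N.+1] and [g = (1 - v) `^ a * S], the
    differential equation for [S] gives
    [g' = - N.+1 * c * v ^+ N * (1 - v) `^ (a - 1)], where [c] is the coefficient of
    order [N.+1]. By [cvg_binom_coef] this tends to 0 uniformly, so [g] is
    uniformly close to [g 0 = 1] by the mean value theorem. *)
Lemma binomial_series_uniform (R : realType) (a r e : R) : 0 <= r < 1 -> 0 < e ->
  \forall N \near \oo, forall v, `|v| <= r ->
    `|(1 - v) `^ (- a) - pseries (binom_coef a) v N| <= e.
Proof.
move=> /andP[r0 r1] e0.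
pose B := (1 - r) `^ (a - 1) + (1 + r) `^ (a - 1).
pose C := (1 - r) `^ (- a) + (1 + r) `^ (- a).
have B0 : 0 <= B by rewrite addr_ge0// powR_ge0.
have C0 : 0 <= C by rewrite addr_ge0// powR_ge0.
have inr (v : R) : `|v| <= r -> 1 - r <= 1 - v <= 1 + r.
  by rewrite ler_norml => /andP[? ?]; lra.
have cv : (fun n => (n.+1%:R * `|binom_coef a n.+1| * r ^+ n) * (B * r * C))
    @ \oo --> (0 : R).
  rewrite -(mul0r (B * r * C)); apply: cvgM; last exact: cvg_cst.
  by apply: cvg_binom_coef; rewrite r0.
have /cvgrPdist_le/(_ e e0)[M _ HM] := cv.
exists M.+1 => // -[//|N] /= MN v vr.
have := HM N MN; rewrite sub0r normrN ger0_norm; last first.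
  by rewrite !mulr_ge0 ?exprn_ge0.
apply: le_trans.
pose g w := (1 - w) `^ a * pseries (binom_coef a) w N.+1.
have g0 : g 0 = 1.
  rewrite /g subr0 powR1 mul1r pseriesS mul0r addr0 /binom_coef /pochhammer.
  by rewrite big_ord0 fact0 divr1.
have v1 : 0 < 1 - v by have := inr _ vr; lra.
have key : `|g v - g 0| <= (N.+1%:R * `|binom_coef a N.+1| * r ^+ N * B) * r.
  apply: (@le_derive_dist0 _ g
    (fun w => - (N.+1%:R * binom_coef a N.+1 * w ^+ N * (1 - w) `^ (a - 1)))) => //.
    move=> x xr.
    have x1 : 0 < 1 - x by have := inr _ xr; lra.
    have [d Hd Ed] := binom_pseries_derive a x N.+1.
    have Hp : is_derive x 1 (fun w : R => (1 - w) `^ a) (- (a * (1 - x) `^ (a - 1))).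
      have := @is_derive1_comp _ (fun w => w `^ a) (fun w => 1 - w) x _ _
        (@is_derive1_powR _ a _ x1) _.
      move=> /(_ (-1)); rewrite mulrN1; apply.
      have H := is_deriveB (is_derive_cst (1 : R) x 1) (is_derive_id x (1 : R)).
      by apply: (is_derive_eq H); rewrite sub0r.
    apply: (is_derive_eq (is_deriveM Hp Hd)).
    rewrite (powR_mulB1 a x1).
    rewrite /GRing.scale/=; move: Ed => /=.
    set S := pseries _ _ _; set P := _ `^ (a - 1) => Ed.
    have -> : (1 - x) * P * d + S * - (a * P) = P * ((1 - x) * d - a * S) by ring.
    by rewrite Ed; ring.
  move=> x xr.
  rewrite normrN 3!normrM (@ger0_norm _ (_ `^ _)) ?powR_ge0//.
  rewrite normrX ger0_norm//.
  apply: ler_pM => //; rewrite ?powR_ge0//.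
    by apply: ler_wpM2l => //; apply: lerXn2r; rewrite ?nnegrE.
  apply: powR_le_endpoints (inr _ xr); lra.
have -> : (1 - v) `^ (- a) - pseries (binom_coef a) v N.+1 =
   (1 - v) `^ (- a) * (g 0 - g v).
  rewrite g0 /g mulrBr mulr1 mulrA -powRD; last by rewrite (gt_eqF v1) implybT.
  by rewrite addNr powRr0 mul1r.
rewrite normrM ger0_norm ?powR_ge0// distrC mulrC !mulrA.
apply: ler_pM => //; rewrite ?powR_ge0//.
apply: powR_le_endpoints (inr _ vr); lra.
Unshelve. all: by end_near. Qed.

(** * Euler's integral and the Gauss hypergeometric function *)

Definition euler_int (R : realType) (i j : nat) (p z : R) : R :=
  \int[lebesgue_measure]_(t in `[0, 1]) (XMonemX i j t * (1 - z * t) `^ p).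

Lemma subr_mul_itv01 (R : realType) (z t : R) : 0 <= t <= 1 ->
  Num.min 1 (1 - z) <= 1 - z * t <= Num.max 1 (1 - z).
Proof.
move=> /andP[t0 t1]; rewrite ge_min le_max.
by have [z0|z0] := leP 0 z; apply/andP; split; apply/orP;
  [right|left|left|right]; nra.
Qed.

Lemma subr_mul_gt0 (R : realType) (z t : R) : z < 1 -> 0 <= t <= 1 -> 0 < 1 - z * t.
Proof.
move=> z1 /(subr_mul_itv01 z)/andP[+ _]; apply: lt_le_trans.
by rewrite lt_min ltr01 subr_gt0.
Qed.

Lemma is_derive_powR_affine (R : realType) (z p t : R) : 0 < 1 - z * t ->
  is_derive t 1 (fun u : R => (1 - z * u) `^ p) (- (z * p * (1 - z * t) `^ (p - 1))).
Proof.
move=> t1.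
have := @is_derive1_comp _ (fun w => w `^ p) (fun u => 1 - z * u) t _ _
  (@is_derive1_powR _ p _ t1) _.
move=> /(_ (- z)); rewrite mulrN (mulrC _ z) mulrA; apply.
have H := is_deriveB (is_derive_cst (1 : R) t 1)
  (is_deriveZ z (is_derive_id t (1 : R))).
by apply: (is_derive_eq H); rewrite sub0r /GRing.scale/= mulr1.
Qed.

Lemma within_continuous_euler (R : realType) (i j : nat) (p z : R) : z < 1 ->
  {within `[0, 1], continuous (fun t => XMonemX i j t * (1 - z * t) `^ p)}.
Proof.
move=> z1; apply: continuous_in_subspaceT => t; rewrite inE/= in_itv/= => t01.
apply: cvgM; first exact: continuous_XMonemX.
suff : {for t, continuous (fun u : R => (1 - z * u) `^ p)} by [].
apply/differentiable_continuous/derivable1_diffP.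
by have ? := is_derive_powR_affine p (subr_mul_gt0 z1 t01); exact: ex_derive.
Qed.

Lemma integrable_euler (R : realType) (i j : nat) (p z : R) : z < 1 ->
  lebesgue_measure.-integrable `[0, 1]
    (EFin \o (fun t => XMonemX i j t * (1 - z * t) `^ p)).
Proof.
move=> z1; apply: continuous_compact_integrable; first exact: segment_compact.
exact: within_continuous_euler.
Qed.

Section euler_expansion.
Context {R : realType} (i j : nat) (a x0 : R) (x01 : x0 < 1).

(** The coefficients obtained by expanding the kernel of Euler's integral around
    [x0] and integrating term by term. *)
Definition euler_coef (n : nat) : R :=
  binom_coef a n * euler_int (i + n) j (- a - n%:R) x0.

(** The integrand of Euler's integral at [x0 + h], with its power of
    [1 - (x0 + h) * t] replaced by a partial sum of its expansion in [h]. *)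
Let kernel (h t : R) (N : nat) : R := XMonemX i j t * (1 - x0 * t) `^ (- a) *
  pseries (binom_coef a) (h * t / (1 - x0 * t)) N.

Lemma euler_partial_sum h N :
  lebesgue_measure.-integrable `[0, 1] (EFin \o (fun t => kernel h t N)) /\
  pseries euler_coef h N = \int[lebesgue_measure]_(t in `[0, 1]) kernel h t N.
Proof.
elim: N => [|N [intN sumN]].
  rewrite (_ : (fun t => kernel h t 0) = cst 0); last first.
    by apply/funext => t; rewrite /kernel /pseries /series/= big_geq// mulr0.
  split; first exact: integrable0.
  by rewrite Rintegral_cst//= mul0r /pseries /series/= big_geq.
have stepE t : 0 <= t <= 1 -> kernel h t N.+1 = kernel h t N +
    binom_coef a N * h ^+ N * (XMonemX (i + N) j t * (1 - x0 * t) `^ (- a - N%:R)).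
  move=> t01; have t1 := subr_mul_gt0 x01 t01.
  rewrite /kernel {1}/pseries /series/= big_nat_recr//= mulrDr; congr (_ + _).
  rewrite powRD; last by rewrite (gt_eqF t1) implybT.
  rewrite powR_invn ?(ltW t1)// /XMonemX exprD !exprMn exprVn.
  by ring.
have intI := integrable_euler (i + N) j (- a - N%:R) x01.
have intZ : lebesgue_measure.-integrable `[0, 1] (EFin \o (fun t =>
    binom_coef a N * h ^+ N * (XMonemX (i + N) j t * (1 - x0 * t) `^ (- a - N%:R)))).
  have H := integrableZl _ (binom_coef a N * h ^+ N) intI.
  by apply: (eq_integrable _ _ _ _ (H _)) => // t _; rewrite /= EFinM.
split.
  have H := integrableD _ intN intZ.
  apply: (eq_integrable _ _ _ _ (H _)) => // t; rewrite inE/= in_itv/= => t01.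
  by rewrite stepE// EFinD.
rewrite /pseries /series/= big_nat_recr//= -[X in X + _]/(pseries _ _ N) sumN.
under [RHS]eq_Rintegral => t.
  by rewrite inE/= in_itv/= => t01; rewrite stepE//; over.
rewrite RintegralD// RintegralZl//; congr (_ + _).
by rewrite /euler_coef mulrAC.
Qed.

(** With [v = (z - x0) * t / (1 - x0 * t)] one has
    [1 - z * t = (1 - x0 * t) * (1 - v)]. Since [t * (1 - x0) <= 1 - x0 * t] for
    [t <= 1], the disc [`|z - x0| < 1 - x0] is exactly where [v] stays, for all [t],
    at absolute value at most [r < 1]; there the binomial series converges
    uniformly in [t], and the integral passes to the limit. *)
Lemma euler_int_expansion z : `|z - x0| < 1 - x0 ->
  pseries euler_coef (z - x0) @ \oo --> euler_int i j (- a) z.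
Proof.
move=> zx0.
have x0' : 0 < 1 - x0 by rewrite subr_gt0.
pose r := `|z - x0| / (1 - x0).
have r01 : 0 <= r < 1 by rewrite divr_ge0 ?(ltW x0')//= ltr_pdivrMr// mul1r.
have z1 : z < 1 by move: zx0; rewrite ltr_norml; lra.
(* [C] bounds [(1 - x0 * t) `^ (- a)]; the summand 1 makes it positive. *)
pose C := (Num.min 1 (1 - x0)) `^ (- a) + (Num.max 1 (1 - x0)) `^ (- a) + 1.
have C0 : 0 < C by rewrite /C ltr_wpDl// addr_ge0// powR_ge0.
apply/cvgrPdist_le => e e0.
have eC : 0 < e / C by rewrite divr_gt0.
have := binomial_series_uniform a r01 eC; apply: filterS => N HN.
have [intN ->] := euler_partial_sum (z - x0) N.
have intz := integrable_euler i j (- a) z1.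
rewrite /euler_int -RintegralB//.
have intB : lebesgue_measure.-integrable `[0, 1] (EFin \o (fun t : R =>
    XMonemX i j t * (1 - z * t) `^ (- a) - kernel (z - x0) t N)).
  have H := integrableB _ intz intN.
  by apply: (eq_integrable _ _ _ _ (H _)) => // t _; rewrite /= EFinB.
apply: le_trans (le_normr_Rintegral _ intB) _ => //.
have -> : e = \int[@lebesgue_measure R]_(t in `[0, 1]) e.
  rewrite Rintegral_cst//= lebesgue_measure_itv/= lte01.
  by rewrite -EFinB /= subr0 mulr1.
apply: le_Rintegral => //.
- exact: integrable_norm.
- apply: continuous_compact_integrable; first exact: segment_compact.
  exact: cst_continuous.
move=> t; rewrite /= in_itv/= => t01; have /andP[t0 t1] := t01.
have tx := subr_mul_gt0 x01 t01.
set v := (z - x0) * t / (1 - x0 * t).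
have vr : `|v| <= r.
  rewrite /v /r !normrM (ger0_norm t0) normfV (gtr0_norm tx).
  rewrite -mulrA ler_wpM2l// ler_pdivrMr// mulrC ler_pdivlMr//.
  lra.
have v1 : 0 < 1 - v by move: vr r01; rewrite ler_norml => /andP[]; lra.
have -> : (1 - z * t) `^ (- a) = (1 - x0 * t) `^ (- a) * (1 - v) `^ (- a).
  rewrite -powRM ?(ltW tx) ?(ltW v1)//; congr (_ `^ _).
  by rewrite /v; field; rewrite gt_eqF.
rewrite /kernel -/v mulrA -mulrBr.
have XM0 : 0 <= XMonemX i j t by rewrite XMonemX_ge0 ?in_itv.
rewrite normrM (ger0_norm (mulr_ge0 XM0 (powR_ge0 _ _))).
apply: (@le_trans _ _ (1 * C * (e / C))).
  apply: ler_pM => //; first by rewrite (mulr_ge0 XM0 (powR_ge0 _ _)).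
    apply: ler_pM; rewrite ?powR_ge0 ?XMonemX_le1 ?in_itv//.
    apply: (le_trans (powR_le_endpoints _ _ (subr_mul_itv01 x0 t01))).
      by rewrite lt_min ltr01.
    by rewrite /C lerDl.
  exact: HN.
by rewrite mul1r mulrC divfK ?gt_eqF.
Qed.

End euler_expansion.

Lemma pochhammer_nat (R : realType) (i n : nat) :
  pochhammer (i.+1%:R : R) n * i`!%:R = (i + n)`!%:R.
Proof.
elim: n => [|n IH]; first by rewrite addn0 /pochhammer big_ord0 mul1r.
by rewrite pochhammerS mulrAC IH addnS factS natrM -natrD mulrC addSn.
Qed.

Lemma gauss_coef_euler (R : realType) (i j : nat) (a : R) (n : nat) :
  gauss_coef a i.+1%:R (i + j).+2%:R n =
  (i + j).+1`!%:R / (i`!%:R * j`!%:R) * euler_coef i j a 0 n.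
Proof.
have fact_neq0 k : k`!%:R != 0 :> R by rewrite pnatr_eq0 -lt0n fact_gt0.
have -> : euler_coef i j a 0 n = binom_coef a n *
    ((i + n)`!%:R * j`!%:R / (i + j + n).+1`!%:R).
  rewrite /euler_coef; congr (_ * _).
  rewrite addnAC -natrM -beta_fun_fact /beta_fun -Rintegral_mkcond.
  by apply: eq_Rintegral => t _; rewrite mul0r subr0 powR1 mulr1.
have p0 : pochhammer ((i + j).+2%:R : R) n != 0.
  have := fact_neq0 ((i + j).+1 + n)%N.
  by rewrite -pochhammer_nat mulf_eq0 negb_or => /andP[].
rewrite -(addSn (i + j) n) -!pochhammer_nat /gauss_coef /binom_coef.
by field; rewrite !fact_neq0 p0.
Qed.

Section hyp2F1_euler.
Context {R : realType} (i j : nat) (a : R).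

Let C : R := (i + j).+1`!%:R / (i`!%:R * j`!%:R).

Lemma is_hyp2F1_euler :
  is_hyp2F1 a i.+1%:R (i + j).+2%:R (fun z => C * euler_int i j (- a) z).
Proof.
split=> [z z1|x x1].
  have -> : gauss_coef a i.+1%:R (i + j).+2%:R = (fun n => C * euler_coef i j a 0 n).
    by apply/funext => n; exact: gauss_coef_euler.
  have -> : pseries (fun n => C * euler_coef i j a 0 n) z =
      (fun n => C * pseries (euler_coef i j a 0) z n).
    apply/funext => n; rewrite /pseries /series/= mulr_sumr.
    by apply: eq_bigr => k _; rewrite mulrA.
  apply: cvgM; first exact: cvg_cst.
  have := @euler_int_expansion R i j a 0 ltr01 z.
  by rewrite !subr0; apply.
exists (fun n => C * euler_coef i j a x n).
near=> z.
have -> : pseries (fun n => C * euler_coef i j a x n) (z - x) =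
    (fun n => C * pseries (euler_coef i j a x) (z - x) n).
  apply/funext => n; rewrite /pseries /series/= mulr_sumr.
  by apply: eq_bigr => k _; rewrite mulrA.
apply: cvgM; first exact: cvg_cst.
apply: euler_int_expansion => //.
near: z; apply/nbhs_ballP; exists (1 - x) => /=; first by rewrite subr_gt0.
by move=> z; rewrite /ball/= distrC.
Unshelve. all: by end_near. Qed.

(** Both functions are the sum of the Gauss series on the unit interval, so their
    difference is an analytic function that vanishes between 0 and 1. *)
Lemma is_hyp2F1_unique (b c : R) (F G : R -> R) :
  is_hyp2F1 a b c F -> is_hyp2F1 a b c G -> forall z, z < 1 -> F z = G z.
Proof.
move=> [F0 Fan] [G0 Gan] z z1; apply/eqP; rewrite -subr_eq0; apply/eqP.
apply: (@analytic_eq0_left R (fun z => F z - G z) 1 0) => // [y y1|y /andP[y0 y1]].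
  by apply: analytic_atB; [exact: Fan|exact: Gan].
have y1' : `|y| < 1 by rewrite gtr0_norm.
by rewrite (cvg_unique _ (F0 _ y1') (G0 _ y1')) ?subrr.
Qed.

(** Uniqueness compares the function selected in the definition of [hyp2F1] with
    Euler's integral, which also guarantees that there is one to select. *)
Lemma hyp2F1_euler z : z < 1 ->
  hyp2F1 a i.+1%:R (i + j).+2%:R z = C * euler_int i j (- a) z.
Proof.
move=> z1; apply: (is_hyp2F1_unique _ is_hyp2F1_euler z1).
rewrite /hyp2F1; case: xgetP => [F -> //|none].
by have := none _ is_hyp2F1_euler.
Qed.

Lemma hyp2F1_0 : hyp2F1 a i.+1%:R (i + j).+2%:R 0 = 1.
Proof.
rewrite hyp2F1_euler ?ltr01//.
have := gauss_coef_euler i j a 0.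
rewrite /gauss_coef /euler_coef /binom_coef /pochhammer !big_ord0 fact0 addn0 subr0.
by rewrite !mulr1 divr1 mul1r => ->.
Qed.

End hyp2F1_euler.

(** * The functional equation of the Gamma function *)

(** Both ends are approached at once: the integrand may be singular at 0. *)
Lemma cvg_integral_exhaust (R : realType) (f : R -> R) :
  (forall t, 0 < t -> 0 <= f t) -> measurable_fun [set: R] f ->
  (\int[lebesgue_measure]_(t in `[(n.+2%:R^-1)%R, n.+2%:R%R]) (f t)%:E)%E @[n --> \oo]
    --> (\int[lebesgue_measure]_(t in `]0%R, +oo[) (f t)%:E)%E.
Proof.
move=> f0 mf.
pose E n : set R := `[n.+2%:R^-1, n.+2%:R]%classic.
have E0 n t : E n t -> 0 < t.
  by rewrite /E/= in_itv/= => /andP[+ _]; apply: lt_le_trans; rewrite invr_gt0.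
have Emono n k t : (n <= k)%N -> E n t -> E k t.
  move=> nk; rewrite /E/= !in_itv/= => /andP[t1 t2]; apply/andP; split.
    by apply: le_trans t1; rewrite lef_pV2 ?posrE// ler_nat !ltnS.
  by apply: le_trans t2 _; rewrite ler_nat !ltnS.
pose g n t : \bar R := (f t * \1_(E n) t)%:E.
have gE n : (\int[lebesgue_measure]_(t in E n) (f t)%:E =
    \int[lebesgue_measure]_(t in `]0%R, +oo[) g n t)%E.
  have {1}-> : E n = `]0, +oo[ `&` E n.
    apply/seteqP; split => t /=; last by case.
    by move=> Et; split => //; rewrite in_itv/= andbT; exact: E0 Et.
  rewrite integral_mkcondr; apply: eq_integral => t _.
  by rewrite /g patchE indicE; case: ifPn => _; rewrite ?mulr1 ?mulr0.
under eq_fun do rewrite gE.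
have -> : (\int[lebesgue_measure]_(t in `]0%R, +oo[) (f t)%:E =
    \int[lebesgue_measure]_(t in `]0%R, +oo[) limn (g^~ t))%E.
  apply: eq_integral => t; rewrite inE/= in_itv/= andbT => t0.
  apply/esym/lim_near_cst => //.
  near=> n; rewrite /g indicE mem_set ?mulr1// /E/= in_itv/=; apply/andP; split.
    rewrite -[leRHS]invrK lef_pV2 ?posrE ?invr_gt0//.
    apply: (@le_trans _ _ n%:R); last by rewrite ler_nat ltnW// ltnW.
    by near: n; exact: nbhs_infty_ger.
  apply: (@le_trans _ _ n%:R); last by rewrite ler_nat ltnW// ltnW.
  by near: n; exact: nbhs_infty_ger.
apply: cvg_monotone_convergence => //.
- move=> n; apply: measurable_funTS; apply/measurable_EFinP.
  by apply: measurable_funM => //; apply: measurable_indic; exact: measurable_itv.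
- move=> n t; rewrite /= in_itv/= andbT => t0.
  by rewrite lee_fin mulr_ge0 ?f0// indicE.
- move=> t; rewrite /= in_itv/= andbT => t0 n k nk.
  rewrite lee_fin ler_wpM2l ?f0// !indicE ler_nat.
  case: (boolP (t \in E n)) => //; rewrite inE => /(Emono _ _ _ nk) Ek.
  by rewrite mem_set.
Unshelve. all: by end_near. Qed.

Lemma is_derive_oppr_expRN (R : realType) (t : R) :
  is_derive t 1 (fun w : R => - expR (- w)) (expR (- t)).
Proof.
have H := @is_derive1_comp _ expR -%R t _ _ (is_derive_expR _)
  (is_deriveN (is_derive_id t 1)).
by apply: (is_derive_eq (is_deriveN H)); rewrite mulrN1 opprK.
Qed.

Section gamma_recurrence.
Context {R : realType}.

Let gfun (x t : R) : R := t `^ x * expR (- t).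

Lemma gfun_cvg_pinfty (x : R) : gfun x n.+2%:R @[n --> \oo] --> (0 : R).
Proof.
(* The exponential dominates [t ^+ k.+1], which exceeds [t `^ x] by a factor [t]. *)
have [k xk] : exists k : nat, x <= k%:R.
  exists (Num.bound `|x|); apply: (le_trans (ler_norm _)); apply/ltW.
  exact: archi_boundP.
apply: (@squeeze_cvgr _ _ _ _ (cst 0) (fun n => k.+1`!%:R * n.+1%:R^-1)); last 2 first.
- exact: cvg_cst.
- rewrite -(mulr0 k.+1`!%:R); apply: cvgM; first exact: cvg_cst.
  exact: cvg_harmonic.
near=> n; rewrite /gfun mulr_ge0 ?powR_ge0 ?expR_ge0//=.
set t : R := n.+2%:R.
have t0 : 0 < t by rewrite ltr0n.
have fk : 0 < k.+1`!%:R :> R by rewrite ltr0n fact_gt0.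
apply: (@le_trans _ _ (k.+1`!%:R * t^-1)); last first.
  by rewrite ler_pM2l// lef_pV2 ?posrE// ler_nat.
rewrite expRN ler_pdivrMr ?expR_gt0// mulrAC ler_pdivlMr//.
apply: (@le_trans _ _ (t ^+ k * t)).
  rewrite ler_pM2r// -powR_mulrn ?(ltW t0)//.
  by rewrite ler_powR// ler1n.
rewrite -exprSr mulrC -ler_pdivrMr//.
by apply: le_trans (expR_ge1Dxn k (ltW t0)); rewrite lerDr.
Unshelve. all: by end_near. Qed.

Lemma gfun_cvg_0 (x : R) : 0 < x -> gfun x n.+2%:R^-1 @[n --> \oo] --> (0 : R).
Proof.
move=> x0.
apply: (@squeeze_cvgr _ _ _ _ (cst 0) (fun n => (n.+2%:R^-1 : R) `^ x)); last 2 first.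
- exact: cvg_cst.
- move: (@powR_cvg0 R x x0) => /cvg_at_rightP; apply; split=> [n|]; first by rewrite invr_gt0.
  by rewrite (cvg_shiftS (@harmonic R)); exact: cvg_harmonic.
near=> n; rewrite /gfun mulr_ge0 ?powR_ge0 ?expR_ge0//=.
rewrite ler_piMr ?powR_ge0// -expR0 ler_expR oppr_le0.
Unshelve. all: by end_near. Qed.

Lemma measurable_gfun (x : R) D : measurable_fun D (gfun x).
Proof.
apply: measurable_funTS; apply: measurable_funM => //.
by apply: measurableT_comp => //; exact: measurable_oppr.
Qed.

Lemma integral_gfun_parts (x u v : R) : 0 < x -> 0 < u < v ->
  (\int[lebesgue_measure]_(t in `[u, v]) (gfun x t)%:E =
   (gfun x u - gfun x v)%:E +
   x%:E * \int[lebesgue_measure]_(t in `[u, v]) (gfun (x - 1) t)%:E)%E.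
Proof.
move=> x0 /andP[u0 uv].
have dpow (p t : R) : 0 < t -> is_derive t 1 (fun w : R => w `^ p) (p * t `^ (p - 1)).
  exact: is_derive1_powR.
have dcont (f : R -> R) (t df : R) : is_derive t 1 f df -> {for t, continuous f}.
  by move=> ?; apply/differentiable_continuous/derivable1_diffP; exact: ex_derive.
have pos t : t \in `]u, v[ -> 0 < t by rewrite in_itv/= => /andP[+ _]; exact: lt_trans.
have posc t : t \in `[u, v] -> 0 < t by rewrite in_itv/= => /andP[+ _]; exact: lt_le_trans.
have cpow p : {within `[u, v], continuous (fun w : R => w `^ p)}.
  by apply: continuous_in_subspaceT => t; rewrite inE => /posc/(dpow p)/dcont.
have v0 : 0 < v by exact: lt_trans uv.
have := @integration_by_parts R (fun w => w `^ x) (fun w => - expR (- w))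
  (fun w => x * w `^ (x - 1)) (fun w => expR (- w)) u v uv.
move=> ->.
- congr (_ + _)%E; first by rewrite /gfun; congr (_%:E); ring.
  rewrite -ge0_integralZl//.
  + rewrite -[RHS]oppeK -integral_ge0N; last first.
      move=> t /posc t0; rewrite /= mule_ge0// lee_fin ?(ltW x0)//.
      by rewrite mulr_ge0 ?powR_ge0 ?expR_ge0.
    congr (- _)%E; apply: eq_integral => t _.
    by rewrite -EFinM -EFinN /gfun; congr EFin; ring.
  + by apply/measurable_EFinP; exact: measurable_gfun.
  + by move=> t _; rewrite lee_fin mulr_ge0 ?powR_ge0 ?expR_ge0.
  + by rewrite lee_fin ltW.
- by move=> t; apply: cvgM; [exact: cvg_cst|exact: cpow].
- split.
  + by move=> t /pos t0; apply: ex_derive; exact: dpow.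
  + by apply: cvg_at_right_filter; apply: (dcont _ _ _ (dpow _ _ _)).
  + by apply: cvg_at_left_filter; apply: (dcont _ _ _ (dpow _ _ _)).
- by move=> t /pos t0; rewrite derive1E; apply: derive_val; exact: dpow.
- apply: continuous_in_subspaceT => t _.
  apply: continuous_comp; first exact: oppr_continuous.
  exact: continuous_expR.
- split.
  + by move=> t _; apply: ex_derive; exact: is_derive_oppr_expRN.
  + by apply: cvg_at_right_filter; apply: (dcont _ _ _ (is_derive_oppr_expRN _)).
  + by apply: cvg_at_left_filter; apply: (dcont _ _ _ (is_derive_oppr_expRN _)).
- by move=> t _; rewrite derive1E; apply: derive_val; exact: is_derive_oppr_expRN.
Qed.

(** Integration by parts holds on the compact intervals from [n.+2%:R^-1] to [n.+2%:R]
    and its boundary terms tend to 0. The limit is taken in the extended reals,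
    where monotone convergence always applies; were the integrals infinite, both
    sides would have the real value 0. *)
Lemma GammaD1 (x : R) : 0 < x -> Gamma (x + 1) = x * Gamma x.
Proof.
move=> x0; rewrite /Gamma addrK /Rintegral.
have gf_ge0 p t : 0 < t -> 0 <= gfun p t.
  by move=> _; rewrite mulr_ge0 ?powR_ge0 ?expR_ge0.
have cB := cvg_integral_exhaust (gf_ge0 x) (@measurable_gfun x setT).
have cA := cvg_integral_exhaust (gf_ge0 (x - 1)) (@measurable_gfun (x - 1) setT).
have xfin : (x%:E \is a fin_num) by [].
set B := (X in fine X = _); set A := (X in x * fine X).
have -> : B = (x%:E * A)%E.
  apply: (cvg_unique _ cB) => //.
  have cc : (gfun x n.+2%:R^-1 - gfun x n.+2%:R)%:E @[n --> \oo] --> (0 : R)%:E.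
    apply: cvg_EFin; first by near=> n.
    rewrite -(subr0 (0 : R)).
    by apply: cvgB; [exact: gfun_cvg_0|exact: gfun_cvg_pinfty].
  have := cvgeD (fin_num_adde_defr _ _) cc (cvgeZl xfin cA).
  rewrite add0e => /(_ _ isT); apply: cvg_trans; apply: near_eq_cvg.
  near=> n; apply/esym/integral_gfun_parts => //.
  by rewrite invr_gt0 ltr0n/= (@lt_trans _ _ 1)// ?ltr1n// invf_lt1// ltr1n.
have : (0 <= A)%E.
  apply: integral_ge0 => t; rewrite /= in_itv/= andbT => /(gf_ge0 (x - 1)).
  by rewrite lee_fin.
case: A => [r _|_|//]; first by [].
by rewrite gt0_muley ?lte_fin//= mulr0.
Unshelve. all: by end_near. Qed.

Lemma Gamma1 : Gamma 1 = 1 :> R.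
Proof.
rewrite /Gamma subrr /Rintegral.
under eq_integral do rewrite powRr0 mul1r.
rewrite integral_itv_obnd_cbnd; last first.
  apply/measurable_EFinP; apply: measurable_funTS.
  by apply: measurableT_comp => //; exact: measurable_oppr.
rewrite (@ge0_continuous_FTC2y R _ (fun w => - expR (- w)) 0 0).
- by rewrite oppr0 expR0 -EFinB/= sub0r opprK.
- by move=> t _; exact: expR_ge0.
- apply: continuous_subspaceT => t; apply: continuous_comp.
    exact: oppr_continuous.
  exact: continuous_expR.
- by rewrite -oppr0; apply: cvgN; exact: cvgr_expR.
- by move=> t _; apply: ex_derive; exact: is_derive_oppr_expRN.
- apply: cvg_at_right_filter.
  suff : {for 0, continuous (fun w : R => - expR (- w))} by [].
  apply/differentiable_continuous/derivable1_diffP.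
  by apply: ex_derive; exact: is_derive_oppr_expRN.
- by move=> t _; rewrite derive1E; apply: derive_val; exact: is_derive_oppr_expRN.
Qed.

End gamma_recurrence.

(** * The first Appell function when its first variable vanishes *)

Lemma Gamma_nat (R : realType) (n : nat) : Gamma (n.+1%:R : R) = n`!%:R.
Proof.
elim: n => [|n IH]; first by rewrite fact0 Gamma1.
by rewrite -natr1 GammaD1 ?ltr0n// IH factS natrM.
Qed.

Lemma integral_subX (R : realType) (s : R) (k : nat) : 0 <= s ->
  (\int[lebesgue_measure]_(t in `[0%R, s]) ((s - t) ^+ k)%:E)%E =
  (s ^+ k.+1 / k.+1%:R)%:E.
Proof.
rewrite le_eqVlt => /predU1P[<-|s0].
  by rewrite set_itv1 integral_set1 expr0n/= mul0r.
have dF (t : R) : is_derive t 1 (fun w : R => - ((s - w) ^+ k.+1 / k.+1%:R)) ((s - t) ^+ k).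
  have H1 : is_derive t 1 (fun w : R => s - w) (- 1).
    have H := is_deriveB (is_derive_cst s t (1 : R)) (is_derive_id t (1 : R)).
    by apply: (is_derive_eq H); rewrite sub0r.
  have H := is_deriveZ (- k.+1%:R^-1) (is_deriveX k.+1 H1).
  rewrite (_ : (fun w : R => _) = - k.+1%:R^-1 *: (fun w : R => s - w) ^+ k.+1).
    apply: (is_derive_eq H); rewrite /GRing.scale/=.
    by rewrite mulrN1 mulrN mulNr opprK mulrA mulVf ?mul1r.
  apply/funext => w; rewrite exprfctE /GRing.scale/= /GRing.scale/=.
  by rewrite mulNr mulrC.
have cF (t : R) : {for t, continuous (fun w : R => - ((s - w) ^+ k.+1 / k.+1%:R))}.
  by apply/differentiable_continuous/derivable1_diffP; exact: ex_derive.
rewrite (@continuous_FTC2 R _ (fun w : R => - ((s - w) ^+ k.+1 / k.+1%:R)))//.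
- by rewrite -EFinB subrr expr0n subr0 mul0r oppr0 sub0r opprK.
- apply: continuous_subspaceT => t.
  apply: (@continuous_comp _ _ _ (fun w : R => s - w) (fun w => w ^+ k)).
    by apply: cvgB; [exact: cvg_cst|exact: cvg_id].
  exact: exprn_continuous.
- split.
  + by move=> t _; exact: ex_derive.
  + by apply: cvg_at_right_filter; exact: cF.
  + by apply: cvg_at_left_filter; exact: cF.
- by move=> t _; rewrite derive1E; exact: derive_val.
Qed.

Section appell_x0.
Context {R : realType} (i k : nat) (a y : R) (y1 : y < 1).

Let chi : R -> R := \1_(`[0, +oo[%classic).

Let chiE (t : R) : chi t = if 0 <= t then 1 else 0.
Proof.
rewrite /chi indicE; case: ifPn => t0.
  by rewrite mem_set//= in_itv/= andbT.
by rewrite memNset//= in_itv/= andbT; exact/negP.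
Qed.

(** The integrand extended by 0 to the whole plane. The indicator of the triangle is
    written as a product of indicators of half-lines, which makes measurability
    on the product space immediate. *)
Let h (z : R * R) : R :=
  z.2 ^+ i * (1 - z.1 - z.2) ^+ k * (1 - y * z.2) `^ (- a) *
  (chi z.1 * chi z.2 * chi (1 - z.1 - z.2)).

Let h_ge0 z : 0 <= h z.
Proof.
rewrite /h !chiE; case: ifPn => z1; last by rewrite !mul0r mulr0.
case: ifPn => z2; last by rewrite mulr0 mul0r mulr0.
case: ifPn => z3; last by rewrite mulr0 mulr0.
by rewrite !mulr1 !mulr_ge0 ?exprn_ge0 ?powR_ge0.
Qed.

Let measurable_h : measurable_fun [set: R * R] h.
Proof.
have mchi : measurable_fun [set: R] chi.
  by apply: measurable_indic; exact: measurable_itv.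
have m3 : measurable_fun [set: R * R] (fun z : R * R => 1 - z.1 - z.2).
  by apply: measurable_funB => //; apply: measurable_funB.
apply: measurable_funM; last first.
  apply: measurable_funM; last exact: measurableT_comp.
  by apply: measurable_funM; exact: measurableT_comp.
apply: measurable_funM.
  by apply: measurable_funM; exact: measurable_funX.
apply: (measurableT_comp (f := fun t : R => t `^ (- a))
  (g := fun z : R * R => 1 - y * z.2)); first exact: measurable_powR.
by apply: measurable_funB => //; apply: measurable_funM.
Qed.

(** The inner integral is that of [(1 - q - p) ^+ k] for [p] between 0 and [1 - q]; its
    antiderivative raises the exponent of [1 - q] to [k.+1]. *)
Let section_h (q : R) :
  (\int[lebesgue_measure]_p (h (p, q))%:E)%E =
  (((fun t => k.+1%:R^-1 * (XMonemX i k.+1 t * (1 - y * t) `^ (- a))) \_ `[0, 1]) q)%:E.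
Proof.
rewrite patchE; case: ifPn => [|qN]; last first.
  rewrite integral0_eq// => p _; rewrite /h/= !chiE.
  case: ifPn => p0; last by rewrite !mul0r mulr0.
  case: ifPn => q0; last by rewrite mulr0 mul0r mulr0.
  case: ifPn => pq; last by rewrite mulr0 mulr0.
  by case/negP: qN; rewrite inE/= in_itv/=; lra.
rewrite inE/= in_itv/= => /andP[q0 q1].
have c0 : 0 <= q ^+ i * (1 - y * q) `^ (- a) by rewrite mulr_ge0 ?powR_ge0 ?exprn_ge0.
transitivity (\int[lebesgue_measure]_(p in `[0%R, (1 - q)%R])
    ((q ^+ i * (1 - y * q) `^ (- a))%:E * ((1 - q - p) ^+ k)%:E))%E.
  rewrite [RHS]integral_mkcond; apply: eq_integral => p _.
  rewrite patchE; case: ifPn => [|pN].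
    rewrite inE/= in_itv/= => /andP[p0 pq].
    rewrite /h/= !chiE p0 q0 (_ : 0 <= 1 - p - q); last by lra.
    by rewrite -EFinM; congr EFin; rewrite !mulr1 mulrAC; congr (_ * _ ^+ _); ring.
  rewrite /h/= !chiE q0; case: ifPn => p0; last by rewrite !mul0r mulr0.
  case: ifPn => pq; last by rewrite mulr0 mulr0.
  by case/negP: pN; rewrite inE/= in_itv/=; lra.
rewrite ge0_integralZl//.
- rewrite integral_subX ?subr_ge0// -EFinM; congr EFin.
  by rewrite /XMonemX; ring.
- apply/measurable_EFinP; apply: measurable_funTS; apply: measurable_funX.
  by apply: measurable_funB.
- move=> p; rewrite /= in_itv/= => /andP[p0 pq].
  by rewrite lee_fin exprn_ge0//; lra.
Qed.

Lemma appellF1_x0 :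
  appellF1 a 1 i.+1%:R (i + k).+3%:R 0 y = hyp2F1 a i.+1%:R (i + k).+3%:R y.
Proof.
have -> : (i + k).+3 = (i + k.+1).+2 by rewrite addnS.
rewrite hyp2F1_euler//.
have ec : (i + k.+1).+2%:R - 1 - i.+1%:R = k.+1%:R :> R.
  rewrite -(addSn _ k.+1) -addSn (_ : i.+2 + k.+1 = 1 + i.+1 + k.+1)%N//.
  by rewrite !natrD; ring.
rewrite /appellF1 ec !Gamma_nat Gamma1 mul1r.
have -> : \int[(lebesgue_measure \x lebesgue_measure)%E]_(z in
      [set z : R * R | [/\ 0 <= z.1, 0 <= z.2 & z.1 + z.2 <= 1]])
    (z.1 `^ (1 - 1) * z.2 `^ (i.+1%:R - 1) * (1 - z.1 - z.2) `^ (k.+1%:R - 1) *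
     (1 - 0 * z.1 - y * z.2) `^ (- a)) =
   k.+1%:R^-1 * euler_int i k.+1 (- a) y.
  transitivity (fine (\int[lebesgue_measure \x lebesgue_measure]_z (h z)%:E)%E).
    congr fine; rewrite integral_mkcond; apply: eq_integral => z _.
    rewrite patchE; case: ifPn => [|zN].
      rewrite inE/= => -[z1 z2 z12].
      have z3 : 0 <= 1 - z.1 - z.2 by lra.
      rewrite /h !chiE z1 z2 z3 !mulr1; congr EFin.
      rewrite subrr powRr0 mul1r mul0r subr0 -!natr1 !addrK.
      by rewrite !powR_mulrn.
    rewrite /h !chiE; congr EFin; case: ifPn => z1; last by rewrite !mul0r mulr0.
    case: ifPn => z2; last by rewrite mulr0 mul0r mulr0.
    case: ifPn => z3; last by rewrite mulr0 mulr0.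
    by case/negP: zN; rewrite inE/=; split => //; lra.
  have mh : measurable_fun [set: R * R] (EFin \o h) by exact/measurable_EFinP.
  transitivity (fine (\int[lebesgue_measure]_q
      \int[lebesgue_measure]_p (h (p, q))%:E)%E).
    congr fine.
    refine (@fubini_tonelli2 _ _ _ _ R (@lebesgue_measure R) (@lebesgue_measure R)
      (EFin \o h) mh _) => z.
    exact: h_ge0.
  under eq_integral do rewrite section_h.
  rewrite -[LHS]/(Rintegral _ _ _) -Rintegral_mkcond RintegralZl//.
  exact: integrable_euler.
have fact_neq0 m : m`!%:R != 0 :> R by rewrite pnatr_eq0 -lt0n fact_gt0.
rewrite [k.+1`!]factS natrM; field.
by rewrite !fact_neq0 nat1r pnatr_eq0.
Qed.

End appell_x0.

(** * Closed forms of Euler's integrals *)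

Section euler_recurrences.
Context {R : realType} (z : R) (z1 : z < 1).

(** Multiply [z * t = 1 - (1 - z * t)] by [(1 - z * t) `^ p]. *)
Lemma euler_intSl (i j : nat) (p : R) :
  z * euler_int i.+1 j p z = euler_int i j p z - euler_int i j (p + 1) z.
Proof.
have intI i' j' q := integrable_euler i' j' q z1.
rewrite /euler_int -RintegralB// -RintegralZl//.
apply: eq_Rintegral => t; rewrite inE/= in_itv/= => t01.
have t1 := subr_mul_gt0 z1 t01.
by rewrite (powR_mulB1 (p + 1) t1) addrK /XMonemX exprS; ring.
Qed.

Lemma euler_intSr (i j : nat) (p : R) :
  euler_int i j.+1 p z = euler_int i j p z - euler_int i.+1 j p z.
Proof.
have intI i' j' q := integrable_euler i' j' q z1.
rewrite /euler_int -RintegralB//.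
apply: eq_Rintegral => t _.
have -> : XMonemX i j.+1 t = XMonemX i j t * (1 - t) by rewrite /XMonemX exprSr mulrA.
by rewrite /XMonemX exprS; ring.
Qed.

(** Multiply [z * (1 - t) = (1 - z * t) - (1 - z)] by [(1 - z * t) `^ p]. *)
Lemma euler_int_subSr (i j : nat) (p : R) :
  z * euler_int i j.+1 p z = euler_int i j (p + 1) z - (1 - z) * euler_int i j p z.
Proof.
rewrite euler_intSr mulrBr euler_intSl.
by move: (euler_int i j p z) (euler_int i j (p + 1) z) => u v; ring.
Qed.

Lemma euler_int00 (p : R) :
  z * p * euler_int 0 0 (p - 1) z = 1 - (1 - z) `^ p.
Proof.
have dF (t : R) : 0 < 1 - z * t -> is_derive t 1 (fun u : R => - (1 - z * u) `^ p)
    (z * p * (1 - z * t) `^ (p - 1)).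
  move=> t1; have H := is_deriveN (is_derive_powR_affine p t1).
  by apply: (is_derive_eq H); rewrite opprK.
have pos (t : R) : t \in `[0, 1] -> 0 < 1 - z * t.
  by rewrite in_itv/=; exact: subr_mul_gt0.
have cF (t : R) : 0 < 1 - z * t -> {for t, continuous (fun u : R => - (1 - z * u) `^ p)}.
  move=> t1; apply/differentiable_continuous/derivable1_diffP.
  by apply: ex_derive; exact: dF.
rewrite -RintegralZl//; last exact: integrable_euler.
rewrite /Rintegral (@continuous_FTC2 R _ (fun u => - (1 - z * u) `^ p))//.
- by rewrite /= mulr1 mulr0 subr0 powR1; ring.
- move=> t; apply: cvgM; first exact: cvg_cst.
  exact: (@within_continuous_euler R 0 0 (p - 1) z z1).
- split.
  + move=> t t01; apply: ex_derive; apply: dF; apply: pos.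
    exact: subset_itv_oo_cc t01.
  + by apply: cvg_at_right_filter; apply: cF; rewrite mulr0 subr0.
  + by apply: cvg_at_left_filter; apply: cF; rewrite mulr1 subr_gt0.
- move=> t t01; rewrite XMonemX00 mul1r derive1E; apply: derive_val.
  apply: dF; apply: pos; exact: subset_itv_oo_cc t01.
Qed.

End euler_recurrences.

(** For [X = s `^ a] this is the integral of [(1 - (1 - s) * t) `^ (- a - k%:R)] over
    [0 <= t <= 1]. Keeping [s `^ a] as a separate variable [X] makes the final
    computation one about rational functions. *)
Definition affine_power_integral (F : fieldType) (a s X : F) (k : nat) : F :=
  (1 - s / X / s ^+ k) / ((1 - s) * (1 - a - k%:R)).

Section euler_closed_forms.
Context {R : realType} (a s : R) (a1 : 1 < a) (s_gt0 : 0 < s) (s1 : s != 1).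

Let y : R := 1 - s.
Let e : nat -> R := affine_power_integral a s (s `^ a).

Let y_lt1 : y < 1. Proof. by rewrite ltrBlDr ltrDl. Qed.

Let y_neq0 : y != 0. Proof. by rewrite subr_eq0 eq_sym. Qed.

Let exponentS k : - a - k.+1%:R + 1 = - a - k%:R :> R.
Proof. by rewrite -natr1; ring. Qed.

Lemma euler_int00_affine k : euler_int 0 0 (- a - k%:R) y = e k.
Proof.
have k0 : 1 - a - k%:R != 0.
  by rewrite lt_eqF// -addrA -opprD subr_lt0 ltr_wpDr.
have := euler_int00 y_lt1 (1 - a - k%:R).
have -> : 1 - y = s by rewrite /y; ring.
rewrite (powR_mulB1 _ s_gt0).
have -> : 1 - a - k%:R - 1 = - a - k%:R by ring.
have -> : s `^ (- a - k%:R) = (s `^ a)^-1 / s ^+ k.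
  by rewrite powRD ?(gt_eqF s_gt0) ?implybT// powRN powR_invn// ltW.
rewrite /e /affine_power_integral -/y mulrA => <-.
by rewrite mulrAC divff ?mul1r// mulf_neq0.
Qed.

Let lower_right i j k : euler_int i j.+1 (- a - k.+1%:R) y =
  (euler_int i j (- a - k%:R) y - s * euler_int i j (- a - k.+1%:R) y) / y.
Proof.
have := euler_int_subSr y_lt1 i j (- a - k.+1%:R).
rewrite exponentS (_ : 1 - y = s); last by rewrite /y; ring.
by move=> <-; rewrite mulrC mulKf.
Qed.

Lemma euler_int02_affine k : euler_int 0 2 (- a - k.+2%:R) y =
  (e k - 2 * s * e k.+1 + s ^+ 2 * e k.+2) / y ^+ 2.
Proof.
rewrite !lower_right !euler_int00_affine; move: (e k) (e k.+1) (e k.+2) => u v w.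
by field.
Qed.

Lemma euler_int03_affine : euler_int 0 3 (- a - 3) y =
  (e 0 - 3 * s * e 1 + 3 * s ^+ 2 * e 2 - s ^+ 3 * e 3) / y ^+ 3.
Proof.
rewrite (lower_right 0 2 2) (euler_int02_affine 0) (euler_int02_affine 1).
move: (e 0) (e 1) (e 2) (e 3) => u v w x.
by field.
Qed.

Lemma euler_int12_affine : euler_int 1 2 (- a - 3) y =
  ((e 1 - 2 * s * e 2 + s ^+ 2 * e 3) / y ^+ 2 -
   (e 0 - 2 * s * e 1 + s ^+ 2 * e 2) / y ^+ 2) / y.
Proof.
have := euler_intSl y_lt1 0 2 (- a - 3).
rewrite (exponentS 2) -(euler_int02_affine 0) -(euler_int02_affine 1) => <-.
by rewrite mulrC mulKf.
Qed.

End euler_closed_forms.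

(** The final formula after the substitutions [X = s `^ a], [G = Gamma (a - 1)] and
    [m = 2 * a]: [I02], [I03], [I12] stand for the Euler integrals and [G1], [G2],
    [G3] for [Gamma (a + 1)], [Gamma (a + 2)], [Gamma (a + 3)]. *)
Lemma closed_form_identity (F : numFieldType) (a s X G : F) :
  a != 0 -> a - 1 != 0 -> a + 1 != 0 -> a + 2 != 0 ->
  s != 0 -> s - 1 != 0 -> X != 0 ->
  let e := affine_power_integral a s X in
  let I02 k := (e k - 2 * s * e k.+1 + s ^+ 2 * e k.+2) / (1 - s) ^+ 2 in
  let I03 := (e 0 - 3 * s * e 1 + 3 * s ^+ 2 * e 2 - s ^+ 3 * e 3)
             / (1 - s) ^+ 3 in
  let I12 := (I02 1 - I02 0) / (1 - s) in
  let G1 := a * ((a - 1) * G) in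
  let G2 := (a + 1) * G1 in
  let G3 := (a + 2) * G2 in
  - (- (1 / 2) * G1 + 2 / (3 * (2 * a)) * G2) * ((X^-1 - 1) / (s - 1))
  + 1 / 3 * (1 + 2 / (2 * a)) * G2 * (3 * I02 0)
  - 1 / (3 * (2 * a)) * G3 * (4 * I03)
  - 1 / (6 * (2 * a)) * G3 * s * (12 * I12) =
  G / (6 * a) * (s - 1) ^- 4 * X^-1 *
  (- 3 * a ^+ 2 * (s - 1) ^+ 2 * (s - 1 + X * (1 + s))
   + 2 * a * ((s - 1) ^+ 3 + (s - 1) * X * (- 2 + s * (7 + s)))
   + a ^+ 3 * (s - 1) ^+ 3 * (X + 1)
   - 12 * s ^+ 2 * (X - 1)).
Proof.
move=> a0 a1 a2 a3 s0 s1 X0 e I02 I03 I12 G1 G2 G3.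
rewrite /I12 /I02 /I03 /e /affine_power_integral /G3 /G2 /G1.
(* Signs are normalised so that the denominators are exactly the factors assumed
   to be nonzero. *)
have -> : 1 - a - 0%:R = - (a - 1) by ring.
have -> : 1 - a - 1%:R = - a by ring.
have -> : 1 - a - 2%:R = - (a + 1) by ring.
have -> : 1 - a - 3%:R = - (a + 2) by ring.
have -> : 1 - s = - (s - 1) by ring.
rewrite !expr1 expr0 divr1.
by field; rewrite X0 s1 a0 a2 s0 a1 a3.
Qed.

Theorem proposition4p8 (R : realType) (m : R) (hm : 2 < m) (s : R) (hs : 0 < s) :
  T_Delta_phi s m =
    - K_Delta_k 1 m * power_quotient m s
    + 1 / 3 * (1 + 2 / m) * Gamma (m / 2 + 2) * hyp2F1 (m / 2 + 2) 1 4 (1 - s)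
    - 1 / (3 * m) * Gamma (m / 2 + 3) * hyp2F1 (m / 2 + 3) 1 5 (1 - s)
    - 1 / (6 * m) * Gamma (m / 2 + 3) * s * hyp2F1 (m / 2 + 3) 2 5 (1 - s)
  /\
  (s != 1 ->
   let a := m / 2 in
   T_Delta_phi s m =
     Gamma (a - 1) / (6 * a) * (s - 1) ^- 4 * s `^ (- a) *
     (- 3 * a ^+ 2 * (s - 1) ^+ 2 * (s - 1 + s `^ a * (1 + s))
      + 2 * a * ((s - 1) ^+ 3 + (s - 1) * s `^ a * (- 2 + s * (7 + s)))
      + a ^+ 3 * (s - 1) ^+ 3 * (s `^ a + 1)
      - 12 * s ^+ 2 * (s `^ a - 1))).
Proof.
have m0 : m != 0 by rewrite gt_eqF// (lt_trans _ hm).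
have z1 : 1 - s < 1 by rewrite ltrBlDr ltrDl.
have hypT : T_Delta_phi s m =
    - K_Delta_k 1 m * power_quotient m s
    + 1 / 3 * (1 + 2 / m) * Gamma (m / 2 + 2) * hyp2F1 (m / 2 + 2) 1 4 (1 - s)
    - 1 / (3 * m) * Gamma (m / 2 + 3) * hyp2F1 (m / 2 + 3) 1 5 (1 - s)
    - 1 / (6 * m) * Gamma (m / 2 + 3) * s * hyp2F1 (m / 2 + 3) 2 5 (1 - s).
  have ss : 1 - s * s^-1 = 0 by rewrite divff ?gt_eqF// subrr.
  rewrite /T_Delta_phi /H_Delta_k ss.
  have -> := @appellF1_x0 R 0 1 (m / 2 + 2) (1 - s) z1.
  have -> := @appellF1_x0 R 0 2 (m / 2 + 3) (1 - s) z1.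
  have -> := @appellF1_x0 R 1 1 (m / 2 + 3) (1 - s) z1.
  (* Only rational arithmetic in [m] and [s] remains; the special values enter as
     indeterminates. *)
  move: (- K_Delta_k 1 m * power_quotient m s) (Gamma (m / 2 + 2))
    (Gamma (m / 2 + 3)) (hyp2F1 _ _ _ _) (hyp2F1 _ _ _ _) (hyp2F1 _ _ _ _).
  by move=> T G2 G3 F1 F2 F3; field.
split=> [//|s1 a].
have a1 : 1 < a by rewrite /a ltr_pdivlMr ?mul1r.
have a0 : 0 < a by exact: lt_trans a1.
have a10 : 0 < a - 1 by rewrite subr_gt0.
have em : m = 2 * a by rewrite /a; field.
have K1 : K_Delta_k 1 m =
    - (1 / 2) * Gamma (a + 1) + 2 / (3 * m) * Gamma (a + 2).
  rewrite /K_Delta_k subrr -/a.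
  have -> := @hyp2F1_0 R 0 1 (a + 1).
  have -> := @hyp2F1_0 R 0 2 (a + 2).
  by congr (_ + _); exact: mulr1.
have c02 : (0 + 2).+1`!%:R / (0`!%:R * 2`!%:R) = 3 :> R.
  by rewrite !factS fact0 !muln1; field.
have c03 : (0 + 3).+1`!%:R / (0`!%:R * 3`!%:R) = 4 :> R.
  by rewrite !factS fact0 !muln1; field.
have c12 : (1 + 2).+1`!%:R / (1`!%:R * 2`!%:R) = 12 :> R.
  by rewrite !factS fact0 !muln1; field.
have e2 : - (a + 2) = - a - 2 by ring.
have e3 : - (a + 3) = - a - 3 by ring.
have F02 := @hyp2F1_euler R 0 2 (a + 2) (1 - s) z1.
rewrite c02 e2 (euler_int02_affine a1 hs s1 0) in F02.
have F03 := @hyp2F1_euler R 0 3 (a + 3) (1 - s) z1.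
rewrite c03 e3 (euler_int03_affine a1 hs s1) in F03.
have F12 := @hyp2F1_euler R 1 2 (a + 3) (1 - s) z1.
rewrite c12 e3 (euler_int12_affine a1 hs s1) in F12.
have G0 : Gamma a = (a - 1) * Gamma (a - 1).
  by have := GammaD1 a10; rewrite subrK.
have G1 : Gamma (a + 1) = a * Gamma a by exact: GammaD1.
have G2 : Gamma (a + 2) = (a + 1) * Gamma (a + 1).
  have -> : a + 2 = a + 1 + 1 by ring.
  by apply: GammaD1; rewrite addr_gt0.
have G3 : Gamma (a + 3) = (a + 2) * Gamma (a + 2).
  have -> : a + 3 = a + 2 + 1 by ring.
  by apply: GammaD1; rewrite addr_gt0.
have := @closed_form_identity R a s (s `^ a) (Gamma (a - 1)).
rewrite hypT K1 /power_quotient (negbTE s1) -/a.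
have -> : hyp2F1 (a + 2) 1 4 (1 - s) = _ := F02.
have -> : hyp2F1 (a + 3) 1 5 (1 - s) = _ := F03.
have -> : hyp2F1 (a + 3) 2 5 (1 - s) = _ := F12.
rewrite G3 G2 G1 G0 em powRN => /= -> //.
- by rewrite gt_eqF.
- by rewrite gt_eqF.
- by rewrite gt_eqF// addr_gt0.
- by rewrite gt_eqF// addr_gt0.
- by rewrite gt_eqF.
- by rewrite subr_eq0.
- by rewrite gt_eqF// powR_gt0.
Qed.
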